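(* (i) Let $n,m,R\ge 1$ be integers. If $p:\mathbb{R}^n\to\mathbb{R}$ is a rank-$R$ homogeneous CP probe of degree $m$ and $A\in\operatorname{GL}(n,\mathbb{R})$, then $p\circ A$ is again a rank-$R$ homogeneous CP probe of degree $m$. (ii) In contrast, monomial sparsity is not preserved in general under precomposition by $\operatorname{GL}(n,\mathbb{R})$: there exist $n$, a real homogeneous polynomial $q$ on $\mathbb{R}^n$ and $A\in\operatorname{GL}(n,\mathbb{R})$ such that $q\circ A$ has strictly more nonzero monomial coefficients than $q$.
   Context: A function $p:\mathbb{R}^n\to\mathbb{R}$ is a rank-$R$ homogeneous CP probe of degree $m$ if there are $\alpha_r\in\mathbb{R}$ and $v_{r,j}\in\mathbb{R}^n$ ($1\le r\le R$, $1\le j\le m$) with $p(x)=\sum_{r=1}^R\alpha_r\prod_{j=1}^m\langle v_{r,j},x\rangle$ for all $x\in\mathbb{R}^n$. Here $\langle\cdot,\cdot\rangle$ is the Euclidean inner product and $(p\circ A)(x)=p(Ax)$. Monomial sparsity of a polynomial is measured by the number of nonzero coefficients in its expansion in the standard monomials $x^\alpha=x_1^{\alpha_1}\cdots x_n^{\alpha_n}$. *)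

(* Defs.v *)
From mathcomp Require Import all_boot all_order all_algebra.
From mathcomp Require Export mpoly.
From mathcomp Require Export reals.

Set Implicit Arguments.
Unset Strict Implicit.
Unset Printing Implicit Defensive.

Import GRing.Theory.
Local Open Scope ring_scope.

Definition dotp (R : realType) (n : nat) (u x : 'cV[R]_n) : R :=
  \sum_(i < n) u i 0 * x i 0.

(* The directions [v r j] need not be distinct and the weights [a r] may vanish,
   so [k] is the number of terms of the decomposition, not a minimal one. *)
Definition is_CP_probe (R : realType) (n k m : nat) (p : 'cV[R]_n -> R) : Prop :=
  exists (a : 'I_k -> R) (v : 'I_k -> 'I_m -> 'cV[R]_n),
    forall x : 'cV[R]_n,
      p x = \sum_(r < k) a r * \prod_(j < m) dotp (v r j) x.

Definition precomp (R : realType) (n : nat) (p : 'cV[R]_n -> R) (A : 'M[R]_n) :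
  'cV[R]_n -> R := fun x => p (A *m x).

Definition mpoly_fun (R : realType) (n : nat) (q : {mpoly R[n]}) :
  'cV[R]_n -> R := fun x => q.@[fun i => x i 0].

Definition mpoly_precomp (R : realType) (n : nat) (q : {mpoly R[n]})
  (A : 'M[R]_n) : {mpoly R[n]} :=
  q \mPo [tuple \sum_(j < n) A i j *: 'X_j | i < n].

(* [mpoly_precomp q A] is the polynomial whose associated function is [q \o A];
   it is the only one, [R] being infinite. *)
Lemma mpoly_precompE (R : realType) (n : nat) (q : {mpoly R[n]}) (A : 'M[R]_n) :
  mpoly_fun (mpoly_precomp q A) =1 precomp (mpoly_fun q) A.
Proof.
move=> x; rewrite /mpoly_fun /precomp /mpoly_precomp comp_mpoly_meval.
apply: meval_eq => i; rewrite tnth_mktuple raddf_sum mxE.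
by apply: eq_bigr => j _; rewrite /= mevalZ mevalXU.
Qed.

(* [msupp q] lists without repetition the monomials with nonzero coefficient. *)
Definition monomial_count (R : realType) (n : nat) (q : {mpoly R[n]}) : nat :=
  size (msupp q).

(* Main.v *)
Require Import Defs.
From mathcomp Require Import all_boot all_order all_algebra.
Local Open Scope ring_scope.

(** Since <v, A x> = <A^T v, x>, the directions of a CP decomposition are
    transported by A^T while its weights are kept. For the monomial count, the
    shear x_0 |-> x_0 + x_1 turns the single monomial x_0 into two. *)

Import GRing.Theory.

Lemma dotp_mulmx (R : realType) (n : nat) (A : 'M[R]_n) (u x : 'cV[R]_n) :
  dotp u (A *m x) = dotp (A^T *m u) x.
Proof.
(* Seen as the single entry of a 1x1 matrix product, the pairing turns adjunction into
   associativity. *)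
have dotpE (y z : 'cV[R]_n) : dotp y z = (y^T *m z) 0 0.
  by rewrite mxE; apply: eq_bigr => i _; rewrite mxE.
by rewrite !dotpE trmx_mul trmxK mulmxA.
Qed.

Lemma is_CP_probe_precomp (R : realType) (n k m : nat) (p : 'cV[R]_n -> R)
    (A : 'M[R]_n) :
  is_CP_probe k m p -> is_CP_probe k m (precomp p A).
Proof.
move=> [a [v pE]]; exists a, (fun r j => A^T *m v r j) => x.
rewrite /precomp pE; apply: eq_bigr => r _; congr (_ * _).
by apply: eq_bigr => j _; rewrite dotp_mulmx.
Qed.

Definition shear (R : realType) : 'M[R]_2 := \matrix_(i, j) (i <= j)%N%:R.

Lemma shear_unitmx (R : realType) : shear R \in unitmx.
Proof.
(* [det_trig] concerns lower triangular matrices, hence the transpose; the diagonal consists of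
   ones. *)
rewrite -unitmx_tr unitmxE det_trig.
  by rewrite big1 ?unitr1 // => i _; rewrite !mxE leqnn.
by apply/is_trig_mxP => i j lt_ij; rewrite !mxE leqNgt lt_ij.
Qed.

Lemma mpoly_precompX_shear (R : realType) :
  mpoly_precomp 'X_0 (shear R) = 'X_0 + 'X_1 :> {mpoly R[2]}.
Proof.
(* Peeling the sum leaves its second index as a [lift], identified with [1] through its value in
   [nat]. *)
by rewrite /mpoly_precomp comp_mpolyXU -tnth_nth tnth_mktuple
  big_ord_recl big_ord1 !mxE !scale1r; congr (_ + 'X_ _); apply: val_inj.
Qed.

(** Since [i != j], each of the two monomials has coefficient 1 + 0 or 0 + 1, so a duplicate-free
    list of length 2 lies in the support. *)
Lemma monomial_count_addX (R : realType) (n : nat) (i j : 'I_n) :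
  i != j -> (1 < monomial_count ('X_i + 'X_j : {mpoly R[n]}))%N.
Proof.
move=> ne_ij.
apply: (@uniq_leq_size _ [:: U_(i)%MM; U_(j)%MM]).
  by rewrite /= inE eq_mnm1 ne_ij.
move=> u; rewrite !inE mcoeff_msupp mcoeffD !mcoeffX => /orP[]/eqP->.
  by rewrite !eq_mnm1 eqxx [j == i]eq_sym (negPf ne_ij) addr0 oner_neq0.
by rewrite !eq_mnm1 eqxx (negPf ne_ij) add0r oner_neq0.
Qed.

Theorem proposition2p5 (R : realType) :
  (forall (n m k : nat) (p : 'cV[R]_n -> R) (A : 'M[R]_n),
     (1 <= n)%N -> (1 <= m)%N -> (1 <= k)%N ->
     is_CP_probe k m p -> A \in unitmx ->
     is_CP_probe k m (precomp p A))
  /\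
  (exists (n d : nat) (q : {mpoly R[n]}) (A : 'M[R]_n),
     [/\ q \is d.-homog,
         A \in unitmx &
         (monomial_count q < monomial_count (mpoly_precomp q A))%N]).
Proof.
split=> [n m k p A _ _ _ pP _|]; first exact: is_CP_probe_precomp.
exists 2%N, 1%N, 'X_0, (shear R); split; last 1 first.
(* The support of ['X_0] is a singleton, so the left count computes to 1. *)
- rewrite mpoly_precompX_shear {1}/monomial_count msuppX.
  exact: monomial_count_addX.
- by rewrite dhomogX /= mdeg1.
- exact: shear_unitmx.
Qed.
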